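(* Let $\varphi:\mathbb{R}^n\to\mathbb{R}$ be of class $\mathcal C^{1,1}$ on a neighborhood of its tilt-stable local minimizer $\bar x$ with modulus $\kappa>0$, and let $\nabla\varphi$ be semismooth$^*$ at $\bar x$. Then there is $\delta>0$ such that for any starting point $x_0\in\mathbb B_\delta(\bar x)$, every sequence $\{x_k\}$ generated by the following algorithm (Algorithm B) is well-defined (the sets $\Upsilon(x_k)$ are nonempty) and, if infinite, converges to $\bar x$ Q-superlinearly, i.e. $\|x_{k+1}-\bar x\|=o(\|x_k-\bar x\|)$. Algorithm B: given $x_k$, if $\nabla\varphi(x_k)=0$ stop; otherwise select $d_k\in\Upsilon(x_k)$ and set $x_{k+1}:=x_k+d_k$, where $\Upsilon(x):=\{y: -\nabla\varphi(x)\in D\nabla\varphi(x)(y)\}$.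
   Context: $\mathcal C^{1,1}$ near $\bar x$: differentiable with locally Lipschitz gradient near $\bar x$. Tangent cone $T_\Omega(\bar x)=\{w:\exists t_k\downarrow0,w_k\to w,\bar x+t_kw_k\in\Omega\}$; graphical derivative of single-valued $f$: $Df(x)(u)=\{w:(u,w)\in T_{\operatorname{gph}f}(x,f(x))\}$. Regular normal cone $\widehat N_\Omega(\bar x)=\{v:\limsup_{x\to\bar x,x\in\Omega}\langle v,x-\bar x\rangle/\|x-\bar x\|\le0\}$. Directional normal cone $N_{\operatorname{gph}F}((\bar x,\bar y);(u,v))$ = all limits of $a_k\in\widehat N_{\operatorname{gph}F}((\bar x,\bar y)+t_k(u_k,v_k))$, $t_k\downarrow0$, $(u_k,v_k)\to(u,v)$; directional coderivative $D^*F((\bar x,\bar y);(u,v))(w)=\{q:(q,-w)\in N_{\operatorname{gph}F}((\bar x,\bar y);(u,v))\}$; $F$ is semismooth$^*$ at $(\bar x,\bar y)$ if for all $(u,v)$, $\langle u^*,u\rangle=\langle v^*,v\rangle$ whenever $u^*\in D^*F((\bar x,\bar y);(u,v))(v^* )$ (for single-valued $f$: at $(\bar x,f(\bar x))$). $\bar x$ is a tilt-stable local minimizer of $\varphi$ with modulus $\kappa>0$ if for some $\gamma>0$ the mapping $M_\gamma(v)=\operatorname{argmin}\{\varphi(x)-\langle v,x\rangle:x\in\mathbb B_\gamma(\bar x)\}$ is single-valued and Lipschitz continuous with constant $\kappa$ on a neighborhood of $0$, with $M_\gamma(0)=\{\bar x\}$. *)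

(* Defs.v *)
From HB Require Import structures.
From mathcomp Require Import all_boot all_order all_algebra.
From mathcomp Require Import all_classical all_reals all_analysis.
Set Implicit Arguments. Unset Strict Implicit. Unset Printing Implicit Defensive.
Import Order.TTheory GRing.Theory Num.Theory.
Import numFieldNormedType.Exports.
Local Open Scope classical_set_scope.
Local Open Scope ring_scope.

Section Defs.
Variables (R : realType) (n : nat).
Notation V := 'rV[R]_n.

Definition dotp (u v : V) : R := \sum_(i < n) u 0 i * v 0 i.
Definition enorm (u : V) : R := Num.sqrt (dotp u u).
Definition enorm2 (u v : V) : R := Num.sqrt (dotp u u + dotp v v).

Definition grad (phi : V -> R) (x : V) : V :=
  \row_(i < n) ('d phi x) (delta_mx 0 i : V).

Definition C11_near (phi : V -> R) (xbar : V) : Prop :=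
  exists r L : R, 0 < r /\
    (forall x, enorm (x - xbar) < r -> differentiable phi x) /\
    (forall x y, enorm (x - xbar) < r -> enorm (y - xbar) < r ->
       enorm (grad phi x - grad phi y) <= L * enorm (x - y)).

Definition cball (xbar : V) (g : R) : set V := [set x | enorm (x - xbar) <= g].

Definition argmin_tilt (phi : V -> R) (xbar : V) (gam : R) (v : V) : set V :=
  [set x | cball xbar gam x /\
     forall y, cball xbar gam y -> phi x - dotp v x <= phi y - dotp v y].

Definition tilt_stable (phi : V -> R) (xbar : V) (kappa : R) : Prop :=
  exists gam eps : R, 0 < gam /\ 0 < eps /\
    exists m : V -> V,
      (forall v, enorm v < eps -> argmin_tilt phi xbar gam v = [set m v]) /\
      m 0 = xbar /\
      (forall v1 v2, enorm v1 < eps -> enorm v2 < eps ->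
          enorm (m v1 - m v2) <= kappa * enorm (v1 - v2)).

(* graphical derivative of a single-valued f : w in Df(x)(u),
   i.e. (u,w) in T_{gph f}(x, f x) *)
Definition graph_deriv (f : V -> V) (x u w : V) : Prop :=
  exists (t : nat -> R) (uk wk : nat -> V),
    (forall k, 0 < t k) /\ t @ \oo --> (0 : R) /\
    uk @ \oo --> u /\ wk @ \oo --> w /\
    (forall k, f (x + t k *: uk k) = f x + t k *: wk k).

(* regular normal cone to gph f at (x,y): (p,q) in N^_{gph f}(x,y)
   (empty if (x,y) is not in gph f) *)
Definition reg_normal_gph (f : V -> V) (x y p q : V) : Prop :=
  y = f x /\
  forall eps : R, 0 < eps -> exists eta : R, 0 < eta /\
    forall z, enorm (z - x) < eta -> enorm (f z - y) < eta ->
      dotp p (z - x) + dotp q (f z - y) <= eps * enorm2 (z - x) (f z - y).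

Definition dir_normal_gph (f : V -> V) (a b u v p q : V) : Prop :=
  exists (t : nat -> R) (uk vk pk qk : nat -> V),
    (forall k, 0 < t k) /\ t @ \oo --> (0 : R) /\
    uk @ \oo --> u /\ vk @ \oo --> v /\ pk @ \oo --> p /\ qk @ \oo --> q /\
    (forall k, reg_normal_gph f (a + t k *: uk k) (b + t k *: vk k) (pk k) (qk k)).

Definition dir_coderiv (f : V -> V) (a b u v w q : V) : Prop :=
  dir_normal_gph f a b u v q (- w).

Definition semismooth_star (f : V -> V) (xbar : V) : Prop :=
  forall u v us vs, dir_coderiv f xbar (f xbar) u v vs us ->
    dotp us u = dotp vs v.

Definition Upsilon (phi : V -> R) (x : V) : set V :=
  [set y | graph_deriv (grad phi) x y (- grad phi x)].

Definition algB_run_upto (phi : V -> R) (x : nat -> V) (k : nat) : Prop :=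
  forall j, (j < k)%N -> grad phi (x j) != 0 /\ Upsilon phi (x j) (x j.+1 - x j).

Definition algB_run_infinite (phi : V -> R) (x : nat -> V) : Prop :=
  forall k, grad phi (x k) != 0 /\ Upsilon phi (x k) (x k.+1 - x k).

End Defs.

(* Main.v *)
(** Write [f] for the gradient. Tilt stability makes [m], the minimizer map of the
    tilted problems, a Lipschitz right inverse of [f] near [0]. It is onto a
    neighborhood of [xbar]: the optimal value is a concave function of the tilt
    [v] with supergradient [- m v], and a maximizer [v] of
    [<v, x> - h v], [h v = <v, m v> - phi (m v)], over a small ball is interior
    when [x] is close to [xbar], which forces [x = m v]. Hence
    [|x - y| <= kappa |f x - f y|] near [xbar]. A Newton direction at [x] is then
    a cluster point of [(m ((1 - t) f x) - x) / t] as [t] decreases to [0].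

    For superlinear convergence, a fuzzy mean value inequality (penalization of
    the distance to a segment) produces regular normals to the graph of [f] at
    points near [x], to which semismoothness* applies, uniformly by compactness.
    This gives [f (x + t (xbar - x)) = f x - t f x + t o(|x - xbar|)] for small
    [t]. A Newton direction [d] satisfies [f (x + t d_t) = f x - t f x + o(t)]
    with [d_t] tending to [d], so metric regularity gives
    [|d - (xbar - x)| <= kappa o(|x - xbar|)]. *)
Require Import Defs.
From HB Require Import structures.
From mathcomp Require Import all_boot all_order all_algebra.
From mathcomp Require Import all_classical all_reals all_analysis.
From mathcomp Require Import ring lra.
Set Implicit Arguments.
Unset Strict Implicit.
Unset Printing Implicit Defensive.
Import Order.TTheory GRing.Theory Num.Theory.
Import numFieldNormedType.Exports.
Local Open Scope classical_set_scope.
Local Open Scope ring_scope.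

(** * Euclidean geometry of row vectors, and its agreement with the ambient topology *)

Section Euclidean.
Context {R : realType} {n : nat}.
Implicit Types u v w : 'rV[R]_n.

Lemma dotpC u v : dotp u v = dotp v u.
Proof. by apply: eq_bigr => i _; rewrite mulrC. Qed.

Lemma dotpDl u v w : dotp (u + v) w = dotp u w + dotp v w.
Proof. by rewrite -big_split; apply: eq_bigr => i _; rewrite mxE mulrDl. Qed.

Lemma dotpZl a u w : dotp (a *: u) w = a * dotp u w.
Proof. by rewrite mulr_sumr; apply: eq_bigr => i _; rewrite mxE mulrA. Qed.

Lemma dotpNl u w : dotp (- u) w = - dotp u w.
Proof. by rewrite -scaleN1r dotpZl mulN1r. Qed.

Lemma dotpDr u v w : dotp w (u + v) = dotp w u + dotp w v.
Proof. by rewrite !(dotpC w) dotpDl. Qed.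

Lemma dotpZr a u w : dotp w (a *: u) = a * dotp w u.
Proof. by rewrite !(dotpC w) dotpZl. Qed.

Lemma dotpNr u w : dotp w (- u) = - dotp w u.
Proof. by rewrite !(dotpC w) dotpNl. Qed.

Definition dotpE := (dotpDl, dotpDr, dotpNl, dotpNr, dotpZl, dotpZr).

Lemma dotp0l u : dotp 0 u = 0.
Proof. by rewrite -(scale0r 0) dotpZl mul0r. Qed.

Lemma dotp_ge0 u : 0 <= dotp u u.
Proof. by apply: sumr_ge0 => i _; rewrite -expr2 sqr_ge0. Qed.

Lemma enorm_ge0 u : 0 <= enorm u.
Proof. exact: sqrtr_ge0. Qed.

Lemma sqr_enorm u : enorm u ^+ 2 = dotp u u.
Proof. by rewrite sqr_sqrtr ?dotp_ge0. Qed.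

Lemma enorm_le u (c : R) : 0 <= c -> dotp u u <= c ^+ 2 -> enorm u <= c.
Proof.
by move=> c0 h; rewrite -(@ler_pXn2r _ 2) ?nnegrE ?enorm_ge0// sqr_enorm.
Qed.

Lemma enorm0 : enorm (0 : 'rV[R]_n) = 0.
Proof. by rewrite /enorm dotp0l sqrtr0. Qed.

Lemma enormZ a u : enorm (a *: u) = `|a| * enorm u.
Proof.
by rewrite /enorm dotpZl dotpZr mulrA -expr2 sqrtrM ?sqr_ge0// sqrtr_sqr.
Qed.

Lemma enormN u : enorm (- u) = enorm u.
Proof. by rewrite /enorm dotpNl dotpNr opprK. Qed.

Lemma enormB u v : enorm (u - v) = enorm (v - u).
Proof. by rewrite -opprB enormN. Qed.

Lemma dotp_eq0 u : dotp u u = 0 -> u = 0.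
Proof.
move=> h; apply/rowP => i; rewrite mxE; apply/eqP; rewrite -sqrf_eq0 expr2.
move/eqP: h; rewrite psumr_eq0; last by move=> j _; rewrite -expr2 sqr_ge0.
by move/allP => /(_ i); rewrite mem_index_enum => /(_ isT).
Qed.

Lemma enorm_eq0 u : enorm u = 0 -> u = 0.
Proof. by move=> h; apply: dotp_eq0; rewrite -sqr_enorm h expr0n. Qed.

Lemma enorm_gt0 u : u != 0 -> 0 < enorm u.
Proof.
by move=> u0; rewrite lt0r enorm_ge0 andbT; apply: contraNneq u0 => /enorm_eq0 ->.
Qed.

Lemma dotp_le u v : dotp u v <= enorm u * enorm v.
Proof.
have [->|v0] := eqVneq v 0; first by rewrite dotpC dotp0l enorm0 mulr0.
have vp := enorm_gt0 v0.
(* This vector is [enorm v] times the component of [u] orthogonal to [v]; its squared norm is the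
   Cauchy-Schwarz gap. *)
have := dotp_ge0 (enorm v *: u - (dotp u v / enorm v) *: v).
rewrite !dotpE -!sqr_enorm (dotpC v u) => h.
have {h} : dotp u v ^+ 2 <= (enorm u * enorm v) ^+ 2.
  rewrite -subr_ge0; apply: le_trans h _; rewrite le_eqVlt; apply/orP; left.
  by apply/eqP; field; rewrite gt_eqF.
have [d0|d0] := leP 0 (dotp u v).
  by rewrite ler_pXn2r // nnegrE mulr_ge0 ?enorm_ge0.
by move=> _; apply: le_trans (ltW d0) _; rewrite mulr_ge0 ?enorm_ge0.
Qed.

Lemma enormD u v : enorm (u + v) <= enorm u + enorm v.
Proof.
apply: enorm_le; first by rewrite addr_ge0 ?enorm_ge0.
by rewrite !dotpE (dotpC v u) -!sqr_enorm; have := dotp_le u v; nra.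
Qed.

Lemma enorm_dist w u v : enorm (u - v) <= enorm (u - w) + enorm (w - v).
Proof. by rewrite -[u - v](subrKA w) enormD. Qed.

Lemma enorm_le_distD u v : enorm u <= enorm (u - v) + enorm v.
Proof. by rewrite -{1}(subrK v u) enormD. Qed.

Lemma mx_norm_le_enorm u : `|u| <= enorm u.
Proof.
rewrite [leLHS]/Num.norm /= mx_normrE; apply: bigmax_le => [|[i j] _] /=.
  exact: enorm_ge0.
rewrite (ord1 i) -sqrtr_sqr ler_sqrt ?dotp_ge0// expr2 /dotp.
by rewrite (bigD1 j)//= lerDl sumr_ge0// => k _; rewrite -expr2 sqr_ge0.
Qed.

(** The crude constant replaces the square root of [n]; it stays positive when [n = 0], so one may
    divide by it. *)
Lemma enorm_le_mx_norm u : enorm u <= (n%:R + 1) * `|u|.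
Proof.
have n1 : 1 <= n%:R + 1 :> R by rewrite lerDr.
have n0 := ler0n R n.
apply: enorm_le; first by rewrite mulr_ge0 // addr_ge0.
have le_u i : `|u 0 i| <= `|u|.
  rewrite [leRHS]/Num.norm /= mx_normrE.
  by apply/bigmax_geP; right => /=; exists (0, i).
apply: (@le_trans _ _ (\sum_(i < n) `|u| ^+ 2)).
  apply: ler_sum => i _; rewrite -expr2 -real_normK ?num_real//.
  by rewrite lerXn2r ?nnegrE.
rewrite sumr_const card_ord -[_ *+ n]mulr_natl exprMn ler_wpM2r ?sqr_ge0//.
by rewrite (@le_trans _ _ (n%:R + 1)) ?lerDl// expr2 ler_peMl// addr_ge0.
Qed.

(** The topology on row vectors comes from the max norm; equivalence of norms transfers convergence
    to [enorm]. *)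
Lemma cvg_enormP {T} {F : set_system T} {FF : Filter F} (f : T -> 'rV[R]_n)
    (l : 'rV[R]_n) :
  f @ F --> l <-> forall e : R, 0 < e -> \forall x \near F, enorm (f x - l) <= e.
Proof.
split=> [/cvgrPdist_le h e e0|h].
  have n1 : 0 < n%:R + 1 :> R by rewrite ltr_wpDl.
  apply: filterS (h _ (divr_gt0 e0 n1)) => x hx; rewrite enormB.
  by apply: le_trans (enorm_le_mx_norm _) _; rewrite mulrC -ler_pdivlMr.
apply/cvgrPdist_le => e /h; apply: filterS => x; rewrite enormB.
exact: le_trans (mx_norm_le_enorm _).
Qed.

Lemma cvg_dotp {T} {F : set_system T} {FF : Filter F} (f g : T -> 'rV[R]_n)
    (u v : 'rV[R]_n) :
  f @ F --> u -> g @ F --> v -> dotp (f x) (g x) @[x --> F] --> dotp u v.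
Proof.
have coord h l i : h @ F --> l -> (h x : 'rV[R]_n) 0 i @[x --> F] --> (l : 'rV[R]_n) 0 i.
  move=> hl.
  by apply: (cvg_comp h (fun M : 'rV[R]_n => M 0 i) hl (@coord_continuous R 1 n 0 i l)).
move=> fu gv; rewrite /dotp; apply: cvg_big => [|i _]; first exact: add_continuous.
by apply: cvgM; exact: coord.
Qed.

Lemma compact_enorm_ball (a : 'rV[R]_n) (r : R) :
  compact [set x | enorm (x - a) <= r].
Proof.
apply: bounded_closed_compact.
  exists (r + enorm a); split; first exact: num_real.
  move=> M rM x /= xr; apply: le_trans (mx_norm_le_enorm _) _.
  by apply: le_trans (enorm_le_distD x a) _; apply: le_trans (ltW rM); rewrite lerD2r.
move=> x cx /=; rewrite leNgt; apply/negP => xr.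
have e0 : 0 < (enorm (x - a) - r) / 2 by rewrite divr_gt0// subr_gt0.
have : \forall y \near x, enorm (y - x) <= (enorm (x - a) - r) / 2.
  by move/(cvg_enormP id x): (@cvg_id _ (nbhs x)) => /(_ _ e0).
move=> /cx [y [/= ya yx]].
by have := enorm_dist y x a; rewrite (enormB x y); move: ya; lra.
Qed.

Lemma cvg_seq_enormP (u : nat -> 'rV[R]_n) (l : 'rV[R]_n) :
  u @ \oo --> l <-> forall e : R, 0 < e ->
    exists N, forall k, (N <= k)%N -> enorm (u k - l) <= e.
Proof.
split=> [/cvg_enormP h e /h [N _ hN]|h]; first by exists N => k; apply: hN.
by apply/cvg_enormP => e /h [N hN]; exists N.
Qed.

Lemma cvg_reindex {T : topologicalType} (u : nat -> T) (l : T) (N : nat -> nat) :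
  (forall k, (k <= N k)%N) -> u @ \oo --> l -> (u \o N) @ \oo --> l.
Proof.
move=> kN ul; apply: cvg_comp ul => A [m _ Am].
by exists m => // k mk; apply: Am; exact: leq_trans mk (kN k).
Qed.

(** Bolzano-Weierstrass. The reindexing need not be increasing: [k <= N k] already preserves limits
    and is stable under composition, so extractions can be chained. *)
Lemma bounded_cvg_reindex (u : nat -> 'rV[R]_n) (C : R) :
  (forall k, enorm (u k) <= C) ->
  exists (l : 'rV[R]_n) N, (forall k, (k <= N k)%N) /\ (u \o N) @ \oo --> l.
Proof.
move=> uC; have [|l [_ ul]] := @compact_enorm_ball 0 C (u k @[k --> \oo]) _.
  by exists 0%N => // k _; rewrite /= subr0.
have /choice[N hN] k : exists m, (k <= m)%N /\ enorm (u m - l) <= k.+1%:R^-1.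
  have [_ [[m km <-] um]] : [set u m | m in [set m | (k <= m)%N]] `&`
      [set x | enorm (x - l) <= k.+1%:R^-1] !=set0.
    apply: ul; first by exists k => // m km; exists m.
    by move/(cvg_enormP id l): (@cvg_id _ (nbhs l)); apply;
       rewrite invr_gt0 ltr0n.
  by exists m.
exists l, N; split=> [k|]; first by have [] := hN k.
apply/cvg_seq_enormP => e e0; have [m me] : exists m, m.+1%:R^-1 < e.
  by have [m _ /(_ m (leqnn m)) me] := near_infty_natSinv_lt (PosNum e0); exists m.
exists m => k mk; have [_ /le_trans -> //] := hN k.
by rewrite (le_trans _ (ltW me))// lef_pV2 ?posrE ?ltr0n// ler_nat.
Qed.

End Euclidean.

(** * A fuzzy mean value inequality by penalization *)

Section FuzzyMeanValue.
Context {R : realType} {n : nat}.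
Implicit Types (f : 'rV[R]_n -> 'rV[R]_n).

Lemma ler_of_small (a b c h0 : R) : 0 < h0 ->
  (forall h, 0 < h -> h <= h0 -> a <= b + h * c) -> a <= b.
Proof.
move=> h00 H; rewrite leNgt; apply/negP => ba.
have d0 : 0 < a - b by rewrite subr_gt0.
have c0 : 0 < `|c| + 1 by rewrite ltr_wpDl.
pose h := Num.min h0 ((a - b) / 2 / (`|c| + 1)).
have hp : 0 < h by rewrite lt_min h00 !divr_gt0.
have h1 : h <= (a - b) / 2 / (`|c| + 1) by rewrite /h ge_min lexx orbT.
have := H h hp; rewrite {1}/h ge_min lexx => /(_ isT).
move: h1; rewrite ler_pdivlMr// => h1.
have := ler_norm c => cn.
have : h * c <= h * (`|c| + 1) by rewrite ler_pM2l//; lra.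
lra.
Qed.

Lemma enorm_le_enorm2 (u v : 'rV[R]_n) : enorm u <= enorm2 u v.
Proof. by rewrite ler_sqrt ?addr_ge0 ?dotp_ge0// lerDl dotp_ge0. Qed.

(* [(p, - z)] being a regular normal to the graph of [f] at [y] encodes that [p]
   is a regular subgradient of [<z, f>] at [y]. *)
Lemma fuzzy_mvt f (a x e z : 'rV[R]_n) (r L t eta rho : R) :
  0 < L -> 0 < t -> 0 < eta -> 0 < rho -> enorm z <= 1 ->
  (forall y y', enorm (y - a) < r -> enorm (y' - a) < r ->
     enorm (f y - f y') <= L * enorm (y - y')) ->
  enorm (x - a) + t * enorm e < r ->
  exists y p, [/\ enorm (y - x) <= t * enorm e + rho,
    enorm p <= 2 * L, reg_normal_gph f y (f y) p (- z) &
    dotp z (f (x + t *: e) - f x) <= t * (dotp p e + eta)].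
Proof.
move=> L0 t0 eta0 rho0 z1 lip xr.
(* Half of the room left in the ball of radius [r] keeps all of [K] where [f] is Lipschitz. *)
pose rho' := Num.min rho ((r - enorm (x - a) - t * enorm e) / 2).
have rho'0 : 0 < rho' by rewrite lt_min rho0/=; lra.
have rho'1 : rho' <= rho by rewrite ge_min lexx.
have rho'2 : rho' <= (r - enorm (x - a) - t * enorm e) / 2.
  by rewrite ge_min lexx orbT.
(* The two terms of [M] force the penalized minimizer [(y, s)] to be close to
   the segment and to satisfy [s < t], respectively. *)
pose M := 2 * L / rho' + L ^+ 2 / (t * eta).
have te0 : 0 < t * eta by rewrite mulr_gt0.
have M0 : 0 < M by rewrite addr_gt0 ?divr_gt0 ?mulr_gt0 ?exprn_gt0.
have M1 : 2 * L <= M * rho'.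
  by rewrite [M * _]mulrDl divfK ?gt_eqF// lerDl mulr_ge0 ?divr_ge0 ?sqr_ge0// ltW.
have M2 : L ^+ 2 <= M * (t * eta).
  rewrite [M * _]mulrDl [X in _ <= _ + X]divfK ?gt_eqF// lerDr.
  by rewrite mulr_ge0 ?divr_ge0 ?mulr_ge0// ltW.
pose g y := dotp z (f y).
(* The mean slope of [g] along the segment, lowered by [eta] so that the endpoint [s = t] cannot be
   optimal. The final inequality amounts to [sl <= dotp p e]. *)
pose sl := (g (x + t *: e) - g x) / t - eta.
have tsl : t * sl = g (x + t *: e) - g x - t * eta.
  by rewrite /sl mulrBr [t * (_ / _)]mulrCA divff ?mulr1 ?gt_eqF.
pose K := [set y | enorm (y - x) <= t * enorm e + rho'].
have Ka y : K y -> enorm (y - a) < r.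
  by rewrite /K /= => Ky; have := enorm_dist x y a; lra.
have gL y y' : K y -> K y' -> g y - g y' <= L * enorm (y - y').
  move=> Ky Ky'; rewrite /g -dotpNr -dotpDr.
  apply: le_trans (dotp_le _ _) _; apply: le_trans (lip _ _ (Ka _ Ky) (Ka _ Ky')).
  by rewrite ler_piMl// enorm_ge0.
have Kx s : 0 <= s -> s <= t -> K (x + s *: e).
  move=> s0 st; rewrite /K /= addrAC subrr add0r enormZ ger0_norm//.
  have := ler_wpM2r (enorm_ge0 e) st; lra.
(* The point and its position on the segment are decoupled: [q] is the gap between them, and [G]
   penalizes it. *)
pose q (w : 'rV[R]_n * R) := w.1 - (x + w.2 *: e).
pose G (w : 'rV[R]_n * R) := g w.1 - w.2 * sl + M * dotp (q w) (q w).
pose D := K `*` `[0, t]%classic.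
have cG : {within D, continuous G}.
  apply/subspace_continuousP => -[y s] [/= Ky _].
  have c1 : w.1 @[w --> within D (nbhs (y, s))] --> y.
    by apply: cvg_within_filter; apply: cvg_fst.
  have c2 : w.2 @[w --> within D (nbhs (y, s))] --> s.
    by apply: cvg_within_filter; apply: cvg_snd.
  have cq : q w @[w --> within D (nbhs (y, s))] --> q (y, s).
    apply: cvgB => //; apply: cvgD; first exact: cvg_cst.
    by apply: cvgZ => //; exact: cvg_cst.
  apply: cvgD; last by apply: cvgM; [exact: cvg_cst|exact: cvg_dotp].
  apply: cvgB; last by apply: cvgM => //; exact: cvg_cst.
  apply/cvgrPdist_le => d d0.
  move/cvg_enormP : c1 => /(_ _ (divr_gt0 d0 L0)); rewrite !near_withinE.
  apply: filterS => -[y' s'] /= h [/= Ky' s't].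
  have {}h : L * enorm (y' - y) <= d by rewrite mulrC -ler_pdivlMr//; apply: h.
  rewrite ler_norml; apply/andP; split.
    by rewrite lerNl opprB; apply: le_trans (gL _ _ Ky' Ky) h.
  by apply: le_trans (gL _ _ Ky Ky') _; rewrite enormB.
have D0 : D !=set0.
  exists (x + 0 *: e, 0); split; first by apply: Kx => //; exact: ltW.
  by rewrite /= in_itv/= lexx ltW.
have cD : compact D.
  by apply: compact_setX; [exact: compact_enorm_ball|exact: segment_compact].
have [[y s]] := compact_EVT_min D0 cD cG.
rewrite inE => -[/= Ky]; rewrite in_itv/= => /andP[s0 st] minG.
have {}minG y' s' : K y' -> 0 <= s' -> s' <= t -> G (y, s) <= G (y', s').
  by move=> Ky' s'0 s't; apply: minG; rewrite inE; split => //=; rewrite in_itv/= s'0.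
have [q0 q0E] : exists q0, q0 = y - (x + s *: e) by exists (y - (x + s *: e)).
(* Comparison with the point [x + s *: e] of the segment, where the penalty vanishes. *)
have qs : M * enorm q0 <= L.
  have := minG _ s (Kx s s0 st) s0 st.
  rewrite /G /q /= subrr dotp0l mulr0 addr0 -q0E -sqr_enorm => h.
  have := gL _ _ (Kx s s0 st) Ky; rewrite enormB -q0E => h2.
  have := enorm_ge0 q0; rewrite le_eqVlt => /predU1P[<-|q00].
    by rewrite mulr0 ltW.
  rewrite -(ler_pM2r q00); nra.
(* If [s = t], comparison with [(x, 0)] bounds a quadratic in [M * enorm q0] by zero; by [M2] its
   discriminant is negative. *)
have slt : s < t.
  rewrite lt_neqAle st andbT; apply/eqP => est.
  have := minG _ 0 (Kx 0 (lexx 0) (ltW t0)) (lexx 0) (ltW t0).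
  rewrite /G /q /= subrr dotp0l mulr0 addr0 -q0E -sqr_enorm mul0r subr0 scale0r addr0.
  have := gL _ _ (Kx s s0 st) Ky; rewrite enormB -q0E est tsl => h2 h3.
  have : M * (t * eta + M * enorm q0 ^+ 2 - L * enorm q0) <= 0.
    by rewrite pmulr_rle0//; lra.
  have := sqr_ge0 (2 * (M * enorm q0) - L); have : 0 < L ^+ 2 by rewrite exprn_gt0.
  nra.
have yx : enorm (y - x) < t * enorm e + rho'.
  have : enorm (y - x) <= enorm q0 + s * enorm e.
    have := enorm_dist (x + s *: e) y x.
    by rewrite -q0E [_ + _ - x]addrAC subrr add0r enormZ ger0_norm.
  have : s * enorm e <= t * enorm e by rewrite ler_wpM2r ?enorm_ge0.
  have : enorm q0 < rho' by rewrite -(ltr_pM2l M0); lra.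
  lra.
(* Minimality in [y] makes minus the gradient of the penalty a regular subgradient of [g]. *)
exists y, ((- (2 * M)) *: q0); split.
- by rewrite (le_trans (ltW yx))// lerD2l.
- rewrite enormZ normrN ger0_norm; last by rewrite mulr_ge0 ?(ltW M0).
  lra.
- split=> // eps eps0.
  (* The first bound keeps [y'] in [K]; the second makes the quadratic remainder [M * enorm w ^+ 2]
     at most [eps * enorm w]. *)
  pose k := Num.min (t * enorm e + rho' - enorm (y - x)) (eps / M).
  have k0 : 0 < k by rewrite lt_min subr_gt0 yx divr_gt0.
  exists k; split=> // y' y'k _.
  have [w wE] : exists w, w = y' - y by exists (y' - y).
  have wk1 : enorm w < t * enorm e + rho' - enorm (y - x).
    by move: y'k; rewrite -wE lt_min => /andP[].
  have wk2 : M * enorm w <= eps.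
    by move: y'k; rewrite -wE lt_min => /andP[_ /ltW]; rewrite ler_pdivlMr// mulrC.
  have Ky' : K y' by rewrite /K /=; have := enorm_dist y y' x; rewrite -wE; lra.
  have := minG _ _ Ky' s0 st.
  have qwE : y' - (x + s *: e) = q0 + w by rewrite q0E wE [RHS]addrC subrKA.
  rewrite /G /q /= -q0E qwE -wE /g !dotpE (dotpC w q0) => h.
  apply: (@le_trans _ _ (eps * enorm w)); last first.
    by rewrite ler_pM2l// enorm_le_enorm2.
  have : M * enorm w * enorm w <= eps * enorm w by rewrite ler_wpM2r ?enorm_ge0.
  have := sqr_enorm w; nra.
rewrite dotpDr dotpNr -/(g _) -/(g _).
(* Since [s < t], the parameter can be increased by a small [h]; minimality divided by [h] gives the
   bound as [h] tends to 0. *)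
have : sl <= dotp (- (2 * M) *: q0) e.
  apply: (@ler_of_small _ _ (M * dotp e e) (t - s)); first by rewrite subr_gt0.
  move=> h h0 hts; have := minG y (s + h) Ky.
  have -> : G (y, s + h) =
      g y - (s + h) * sl + M * dotp (q0 - h *: e) (q0 - h *: e).
    by rewrite /G /q /= scalerDl addrA opprD addrA q0E.
  rewrite /G /q /= -q0E !dotpE (dotpC e q0) => minh.
  have {}minh := minh ltac:(lra) ltac:(lra).
  rewrite -(ler_pM2l h0); lra.
rewrite -(ler_pM2l t0) tsl; lra.
Qed.

End FuzzyMeanValue.

(** * From semismoothness* to a uniform estimate along segments to the base point *)

Section DirectionalEstimate.
Context {R : realType} {n : nat}.
Variables (f : 'rV[R]_n -> 'rV[R]_n) (a : 'rV[R]_n) (r L : R).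
Hypotheses (r0 : 0 < r) (L0 : 0 < L).
Hypothesis lip : forall y y', enorm (y - a) < r -> enorm (y' - a) < r ->
  enorm (f y - f y') <= L * enorm (y - y').

(** Counterexamples [y k] approaching [a], rescaled by their distance to [a], have bounded
    directions, difference quotients and normals. A common cluster point is a directional normal
    that violates semismoothness*. *)
Lemma semismooth_star_uniform (C eps : R) : semismooth_star f a -> 0 < eps ->
  exists2 delta : R, 0 < delta & forall y p z,
    enorm (y - a) < delta -> enorm p <= C -> enorm z <= 1 ->
    reg_normal_gph f y (f y) p (- z) ->
    dotp p (a - y) <= dotp z (f a - f y) + eps * enorm (y - a).
Proof.
move=> ss eps0; apply: contrapT => nex.
have /choice[Y] k : exists ypz : 'rV[R]_n * 'rV[R]_n * 'rV[R]_n,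
    let: (y, p, z) := ypz in
    [/\ enorm (y - a) < Num.min r k.+1%:R^-1, enorm p <= C, enorm z <= 1,
      reg_normal_gph f y (f y) p (- z) &
      dotp z (f a - f y) + eps * enorm (y - a) < dotp p (a - y)].
  apply: contrapT => nk; apply: nex; exists (Num.min r k.+1%:R^-1).
    by rewrite lt_min r0 invr_gt0 ltr0n.
  move=> y p z ya pC z1 rn; rewrite leNgt; apply/negP => lt.
  by apply: nk; exists (y, p, z).
pose y k := (Y k).1.1; pose p k := (Y k).1.2; pose z k := (Y k).2 => HY.
have {}HY k : [/\ enorm (y k - a) < Num.min r k.+1%:R^-1, enorm (p k) <= C,
      enorm (z k) <= 1, reg_normal_gph f (y k) (f (y k)) (p k) (- z k) &
      dotp (z k) (f a - f (y k)) + eps * enorm (y k - a) < dotp (p k) (a - y k)].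
  by rewrite /y /p /z; have := HY k; case: (Y k) => -[].
pose t k := enorm (y k - a).
(* At [y k = a] the strict violation would read [0 < 0]. *)
have t0 k : 0 < t k.
  apply: enorm_gt0; rewrite subr_eq0; apply/eqP => ya.
  have [_ _ _ _] := HY k; rewrite ya !subrr enorm0 !(dotpC _ 0) !dotp0l.
  by rewrite mulr0 addr0 ltxx.
have tr k : t k < r by have [+ _ _ _ _] := HY k; rewrite lt_min => /andP[].
have tk k : t k < k.+1%:R^-1 by have [+ _ _ _ _] := HY k; rewrite lt_min => /andP[].
pose u k := (t k)^-1 *: (y k - a); pose v k := (t k)^-1 *: (f (y k) - f a).
have tu k : a + t k *: u k = y k.
  by rewrite scalerA divff ?gt_eqF// scale1r addrC subrK.
have tv k : f a + t k *: v k = f (y k).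
  by rewrite scalerA divff ?gt_eqF// scale1r addrC subrK.
have u1 k : enorm (u k) <= 1.
  by rewrite enormZ gtr0_norm ?invr_gt0// mulVf ?gt_eqF.
have v1 k : enorm (v k) <= L.
  rewrite enormZ gtr0_norm ?invr_gt0// mulrC ler_pdivrMr//.
  by apply: lip (tr k) _; rewrite subrr enorm0.
have [ul [N1 [kN1 cu]]] := bounded_cvg_reindex u1.
have [vl [N2 [kN2 cv]]] := bounded_cvg_reindex (fun k => v1 (N1 k)).
have [pl [N3 [kN3 cp]]] : exists (l : 'rV[R]_n) N, (forall k, (k <= N k)%N) /\
    ((fun k => p (N1 (N2 k))) \o N) @ \oo --> l.
  by apply: (@bounded_cvg_reindex _ _ _ C) => k; have [] := HY (N1 (N2 k)).
have [zl [N4 [kN4 cz]]] : exists (l : 'rV[R]_n) N, (forall k, (k <= N k)%N) /\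
    ((fun k => z (N1 (N2 (N3 k)))) \o N) @ \oo --> l.
  by apply: (@bounded_cvg_reindex _ _ _ 1) => k; have [] := HY (N1 (N2 (N3 k))).
pose N k := N1 (N2 (N3 (N4 k))).
have kN k : (k <= N k)%N.
  by rewrite (leq_trans (kN4 k))// (leq_trans (kN3 _))// (leq_trans (kN2 _)).
have {}cu : (u \o N) @ \oo --> ul.
  apply: (@cvg_reindex _ (u \o N1) ul (fun k => N2 (N3 (N4 k)))) cu => k.
  by rewrite (leq_trans (kN4 k))// (leq_trans (kN3 _)).
have {}cv : (v \o N) @ \oo --> vl.
  apply: (@cvg_reindex _ (v \o N1 \o N2) vl (fun k => N3 (N4 k))) cv => k.
  by rewrite (leq_trans (kN4 k)).
have {}cp : (p \o N) @ \oo --> pl.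
  exact: (@cvg_reindex _ (p \o N1 \o N2 \o N3) pl N4 kN4) cp.
have ct : t @ \oo --> (0 : R).
  apply/cvgrPdist_le => e e0.
  have := near_infty_natSinv_lt (PosNum e0); apply: filterS => k /= ke.
  by rewrite sub0r normrN gtr0_norm// ltW// (lt_trans (tk k)).
have pu_zv : dotp pl ul = dotp zl vl.
  apply: (ss ul vl); exists (t \o N), (u \o N), (v \o N), (p \o N), (\- (z \o N)).
  split=> [k|]; first exact: t0.
  split; first exact: (@cvg_reindex _ t 0 N kN).
  do 3 (split=> //); split; first exact: cvgN.
  by move=> k /=; rewrite tu tv; have [] := HY (N k).
have lim : dotp (z (N k)) (v (N k)) - dotp (p (N k)) (u (N k)) @[k --> \oo] -->
    dotp zl vl - dotp pl ul by apply: cvgB; exact: cvg_dotp.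
(* The violated inequality, divided by [t k], passes to the limit. *)
have : eps <= dotp zl vl - dotp pl ul.
  apply: (cvgr_to_ge lim); exists 0%N => // k _ /=.
  have [_ _ _ _] := HY (N k); rewrite -[a - _]opprB -[f a - _]opprB !dotpNr.
  rewrite /u /v !dotpZr -(ler_pM2l (t0 (N k))) -/(t _) mulrBr !mulrA divff ?gt_eqF//.
  lra.
by rewrite pu_zv subrr leNgt eps0.
Qed.

(** The error [D] is tested against its own unit direction [z]. The mean value inequality bounds it
    through a normal at some [y] near [x], and the uniform estimate applies at [y]. *)
Lemma semismooth_star_directional (eps : R) : semismooth_star f a -> 0 < eps ->
  exists2 delta : R, 0 < delta & forall x, enorm (x - a) < delta ->
    exists2 tau : R, 0 < tau & forall t, 0 < t -> t <= tau ->
      enorm (f (x + t *: (a - x)) - f x + t *: (f x - f a)) <=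
        t * (eps * enorm (x - a)).
Proof.
move=> ss eps0; have e0 : 0 < eps / 4 by rewrite divr_gt0.
have [d0 d00 Hd0] := semismooth_star_uniform (2 * L) ss e0.
exists (Num.min d0 r / 2); first by rewrite divr_gt0// lt_min d00.
move=> x xa; have {xa}[xd0 xr] : enorm (x - a) < d0 / 2 /\ enorm (x - a) < r / 2.
  have : Num.min d0 r <= d0 by rewrite ge_min lexx.
  have : Num.min d0 r <= r by rewrite ge_min lexx orbT.
  by split; lra.
have [->|xa] := eqVneq x a.
  exists 1 => // t t0 _.
  by rewrite !subrr !scaler0 !addr0 subrr !enorm0 !mulr0.
have xa0 : 0 < enorm (x - a) by rewrite enorm_gt0// subr_eq0.
(* The bound [2^-1] keeps [y] within [2 * enorm (x - a)] of [a]. The other absorbs the cost of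
   replacing [x] by [y]: a total of [3 * L] times [enorm (y - x) <= 2 * t * enorm (x - a)]. *)
pose tau := Num.min (2^-1) (eps / 4 / (6 * L)).
exists tau; first by rewrite lt_min invr_gt0 ltr0n divr_gt0// mulr_gt0.
move=> t t0; rewrite le_min ler_pdivlMr ?mulr_gt0// => /andP[t1 t2].
set D := _ + t *: (f x - f a).
have [->|D0] := eqVneq D 0.
  by rewrite enorm0 !mulr_ge0 ?enorm_ge0// ltW.
have Dp := enorm_gt0 D0.
pose z := (enorm D)^-1 *: D.
have z1 : enorm z <= 1 by rewrite enormZ gtr0_norm ?invr_gt0// mulVf ?gt_eqF.
have zD : dotp z D = enorm D.
  by rewrite dotpZl -sqr_enorm expr2 mulKf ?gt_eqF.
have te : t * enorm (a - x) <= enorm (x - a) / 2.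
  by rewrite enormB mulrC ler_wpM2l// ltW.
have te0 : 0 < t * enorm (x - a) by rewrite mulr_gt0.
have [||y [p [yx p2 rn fz]]] :=
  @fuzzy_mvt R n f a x (a - x) z r L t (eps / 4 * enorm (x - a)) (t * enorm (x - a))
    L0 t0 _ te0 z1 lip; [by rewrite mulr_gt0|by lra|].
rewrite enormB in te; rewrite (enormB a) in yx.
have ya : enorm (y - a) <= 2 * enorm (x - a) by have := enorm_dist x y a; lra.
have := Hd0 y p z _ p2 z1 rn; rewrite -{1}(opprB a) => /(_ _)/wrap[|uni].
  by rewrite enormN -enormN opprB; lra.
have yr : enorm (y - a) < r by lra.
have fxy : dotp z (f x - f y) <= L * enorm (y - x).
  apply: le_trans (dotp_le _ _) _; rewrite enormB.
  have := lip yr (lt_trans xr _); rewrite ltr_pdivrMr// ltr_pMr// ltr1n => /(_ isT).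
  apply: le_trans; rewrite enormB ler_piMl ?enorm_ge0//.
have pyx : dotp p (y - x) <= 2 * L * enorm (y - x).
  by apply: le_trans (dotp_le _ _) _; rewrite ler_wpM2r ?enorm_ge0.
have : enorm D <= t * (dotp p (a - x) + eps / 4 * enorm (x - a) + dotp z (f x - f a)).
  have DE : dotp z D = dotp z (f (x + t *: (a - x)) - f x) + t * dotp z (f x - f a).
    by rewrite [LHS]dotpDr dotpZr.
  by rewrite -zD DE; lra.
move=> /le_trans; apply; rewrite ler_pM2l//.
have -> : dotp p (a - x) = dotp p (a - y) + dotp p (y - x).
  by rewrite -dotpDr addrC addrA subrK addrC.
have : dotp z (f a - f y) + dotp z (f x - f a) = dotp z (f x - f y).
  by rewrite -dotpDr addrC addrA subrK.
have : eps / 4 * enorm (y - a) <= eps / 4 * (2 * enorm (x - a)).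
  by rewrite ler_pM2l.
have : L * enorm (y - x) <= L * (2 * (t * enorm (x - a))).
  by rewrite ler_pM2l//; lra.
have : t * (6 * L) * enorm (x - a) <= eps / 4 * enorm (x - a).
  by rewrite ler_pM2r.
lra.
Qed.

End DirectionalEstimate.

(** * Tilt stability gives a local Lipschitz inverse of the gradient *)

Section GradientInverse.
Context {R : realType} {n : nat}.
Implicit Types (phi : 'rV[R]_n -> R) (x v : 'rV[R]_n).

Lemma diff_dotp_grad phi x h : differentiable phi x ->
  'd phi x h = dotp (grad phi x) h.
Proof.
move=> dx; rewrite {1}(row_sum_delta h) linear_sum /dotp; apply: eq_bigr => i _.
by rewrite linearZ /= mulrC mxE.
Qed.

Lemma differentiable_grad_expansion phi x (eps : R) : differentiable phi x -> 0 < eps ->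
  exists2 delta : R, 0 < delta & forall h, enorm h < delta ->
    `|phi (x + h) - phi x - dotp (grad phi x) h| <= eps * enorm h.
Proof.
move=> dx eps0; have /eqaddoP /(_ _ eps0) := diff_locally dx.
move=> /nbhs_ballP [d /= d0 hd]; exists d => // h hd'.
have /hd /= : ball 0 d h.
  rewrite -ball_normE /= sub0r normrN; exact: le_lt_trans (mx_norm_le_enorm h) hd'.
have -> : (phi \o +%R^~ x - (cst (phi x) + 'd phi x)) h =
    phi (x + h) - phi x - dotp (grad phi x) h.
  by rewrite -diff_dotp_grad// (addrC x) -addrA -opprD.
move=> /le_trans; apply.
by rewrite ler_pM2l// mx_norm_le_enorm.
Qed.

(** Otherwise a short step along [w = v - grad phi x] would decrease the tilted function to first
    order. *)
Lemma grad_tilted_min phi x v (s : R) : differentiable phi x -> 0 < s ->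
  (forall y, enorm (y - x) < s -> phi x - dotp v x <= phi y - dotp v y) ->
  grad phi x = v.
Proof.
move=> dx s0 minx; apply/esym/eqP; rewrite -subr_eq0; apply/eqP/enorm_eq0.
have [w wE] : exists w, w = v - grad phi x by exists (v - grad phi x).
rewrite -wE; apply: le_anti; rewrite enorm_ge0 andbT.
rewrite leNgt; apply/negP => w0.
have [d d0 hd] := differentiable_grad_expansion dx (divr_gt0 w0 (ltr0n R 2)).
pose t := Num.min s d / (2 * enorm w).
have m0 : 0 < Num.min s d by rewrite lt_min s0.
have t0 : 0 < t by rewrite divr_gt0// mulr_gt0.
have tw : enorm (t *: w) = Num.min s d / 2.
  by rewrite enormZ gtr0_norm// /t; field; rewrite gt_eqF.
have [ms md] : Num.min s d / 2 < s /\ Num.min s d / 2 < d.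
  have : Num.min s d <= s by rewrite ge_min lexx.
  have : Num.min s d <= d by rewrite ge_min lexx orbT.
  by split; lra.
have := minx (x + t *: w); rewrite addrAC subrr add0r tw => /(_ ms).
have := hd (t *: w); rewrite tw => /(_ md) /ler_normlP[_].
rewrite -tw enormZ gtr0_norm// !dotpE => h1 h2.
have : t * dotp w w <= t * (enorm w / 2 * enorm w).
  by rewrite {1}wE dotpDl dotpNl; lra.
by rewrite ler_pM2l// -sqr_enorm; have : 0 < enorm w ^+ 2 by [rewrite exprn_gt0]; nra.
Qed.

Lemma within_continuous_lipschitz (A : set 'rV[R]_n) (g : 'rV[R]_n -> R) (K : R) :
  0 < K -> (forall x y, A x -> A y -> g x - g y <= K * enorm (x - y)) ->
  {within A, continuous g}.
Proof.
move=> K0 gK; apply/subspace_continuousP => x Ax.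
apply/cvgrPdist_le => d d0.
move/(cvg_enormP id x): (@cvg_id _ (nbhs x)) => /(_ _ (divr_gt0 d0 K0)).
rewrite near_withinE; apply: filterS => y /= h Ay.
have {}h : K * enorm (y - x) <= d by rewrite mulrC -ler_pdivlMr.
rewrite ler_norml; apply/andP; split.
  by rewrite lerNl opprB; apply: le_trans (gK _ _ Ay Ax) h.
by apply: le_trans (gK _ _ Ax Ay) _; rewrite enormB.
Qed.

Lemma tilt_stable_grad_inverse phi xbar (kappa r : R) :
  0 < kappa -> 0 < r ->
  (forall x, enorm (x - xbar) < r -> differentiable phi x) ->
  tilt_stable phi xbar kappa ->
  exists (m : 'rV[R]_n -> 'rV[R]_n) (rho rho0 : R), [/\ 0 < rho, 0 < rho0,
    forall v1 v2, enorm v1 < rho -> enorm v2 < rho ->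
      enorm (m v1 - m v2) <= kappa * enorm (v1 - v2),
    forall v, enorm v < rho -> grad phi (m v) = v &
    forall x, enorm (x - xbar) < rho0 ->
      enorm (grad phi x) < rho /\ m (grad phi x) = x] /\ grad phi xbar = 0.
Proof.
move=> k0 r0 dphi [gam [eps [gam0 [eps0 [m [mE [m0 mlip]]]]]]].
(* For tilts below [rho], the Lipschitz bound puts [m v] inside the open ball of radius [gam], where
   first-order optimality holds, and in the region of differentiability. *)
pose rho := Num.min eps (Num.min r gam / kappa).
have rg0 : 0 < Num.min r gam by rewrite lt_min r0.
have rho0 : 0 < rho by rewrite lt_min eps0 divr_gt0.
have rho_eps : rho <= eps by rewrite ge_min lexx.
have mball v : enorm v < rho -> enorm (m v - xbar) < Num.min r gam.
  rewrite lt_min ltr_pdivlMr// mulrC => /andP[v1 v2].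
  rewrite -m0; apply: le_lt_trans (mlip _ _ v1 _) _; first by rewrite enorm0.
  by rewrite subr0.
have mmin v : enorm v < eps -> argmin_tilt phi xbar gam v (m v) by move=> /mE ->.
have gm v : enorm v < rho -> grad phi (m v) = v.
  move=> vr; have := mball v vr; rewrite lt_min => /andP[mr mg].
  apply: (@grad_tilted_min _ _ _ (gam - enorm (m v - xbar))).
  - exact: dphi.
  - by rewrite subr_gt0.
  move=> y ym; have [_] := mmin v (lt_le_trans vr rho_eps); apply.
  by rewrite /cball /=; have := enorm_dist (m v) y xbar; lra.
have g0 : grad phi xbar = 0 by rewrite -m0 gm// enorm0.
pose rho1 := rho / 2.
have rho10 : 0 < rho1 by rewrite divr_gt0.
have rho1e : rho1 < eps by rewrite /rho1; lra.
(* The convex conjugate of [phi] restricted to the ball of radius [gam]; [h_sub] says that [m v'] is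
   a subgradient of it at [v']. *)
pose h v := dotp v (m v) - phi (m v).
have h_ge v y : enorm v < eps -> enorm (y - xbar) <= gam -> dotp v y - phi y <= h v.
  by move=> ve yg; have [_ /(_ _ yg)] := mmin v ve; rewrite /h; lra.
have h_sub v v' : enorm v < eps -> enorm v' < eps -> h v' - h v <= dotp (v' - v) (m v').
  move=> ve ve'; have [mg _] := mmin _ ve'.
  by have := h_ge v _ ve mg; rewrite {2}/h dotpDl dotpNl; lra.
have dxbar : differentiable phi xbar by apply: dphi; rewrite subrr enorm0.
have [d d0 hd] := differentiable_grad_expansion dxbar (divr_gt0 rho10 (ltr0n R 2)).
pose s := Num.min d gam / (2 * rho1).
have dg0 : 0 < Num.min d gam by rewrite lt_min d0.
have s0 : 0 < s by rewrite divr_gt0// mulr_gt0.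
(* The test point [xbar + s *: v] gains [s * rho1 ^+ 2] from the tilt and loses at most half of that
   in the expansion of [phi] at its critical point [xbar]. *)
have h_sphere v : enorm v = rho1 ->
    dotp v xbar - phi xbar + s * rho1 ^+ 2 / 2 <= h v.
  move=> v1; have sv : enorm (s *: v) = Num.min d gam / 2.
    by rewrite enormZ v1 gtr0_norm// /s; field; rewrite gt_eqF.
  have [md mg] : Num.min d gam / 2 < d /\ Num.min d gam / 2 < gam.
    have : Num.min d gam <= d by rewrite ge_min lexx.
    have : Num.min d gam <= gam by rewrite ge_min lexx orbT.
    by split; lra.
  have := hd (s *: v); rewrite sv g0 => /(_ md) /ler_normlP[_].
  rewrite -sv enormZ v1 gtr0_norm// dotp0l subr0.
  have := h_ge v (xbar + s *: v); rewrite v1 addrAC subrr add0r sv !dotpE -sqr_enorm v1.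
  by move=> /(_ rho1e (ltW mg)); lra.
pose B := enorm xbar + kappa * eps.
have mB v : enorm v < eps -> enorm (m v) <= B.
  move=> ve; have := enorm_le_distD (m v) (m 0).
  have := mlip v 0 ve; rewrite enorm0 subr0 => /(_ eps0).
  have : kappa * enorm v <= kappa * eps by rewrite ler_pM2l// ltW.
  by rewrite m0 /B; lra.
exists m, rho, (s * rho1 / 2); split=> //; split=> //.
- by rewrite divr_gt0// mulr_gt0.
- by move=> v1 v2 v1r v2r; apply: mlip; apply: lt_le_trans rho_eps.
move=> x xs.
pose F v := dotp v x - h v.
have F_cont : {within [set v | enorm (v - 0) <= rho1], continuous F}.
  apply: (@within_continuous_lipschitz _ _ (enorm x + B + 1)) => [|v v' /=].
    by rewrite ltr_wpDl// !addr_ge0 ?mulr_ge0 ?enorm_ge0// ltW.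
  rewrite !subr0 => v1 v1'.
  have ve := le_lt_trans v1 rho1e; have ve' := le_lt_trans v1' rho1e.
  have := h_sub v v' ve ve'; have := dotp_le (v - v') x.
  have := dotp_le (v' - v) (m v'); rewrite (enormB v' v) /F !(dotpDl, dotpNl).
  have := ler_wpM2l (enorm_ge0 (v - v')) (mB _ ve').
  have := enorm_ge0 (v - v'); lra.
have [||v] := EVT_max_rV _ _ F_cont; [|exact: compact_enorm_ball|].
  by exists 0; rewrite /= subr0 enorm0 ltW.
rewrite inE /= subr0 => v1 vmax.
have {}vmax v' : enorm v' <= rho1 -> F v' <= F v.
  by move=> v'1; apply: vmax; rewrite inE /= subr0.
have ve := le_lt_trans v1 rho1e.
(* On the sphere, [h_sphere] and the closeness of [x] to [xbar] would make [F v] smaller than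
   [F 0]. *)
have v2 : enorm v < rho1.
  rewrite lt_neqAle v1 andbT; apply/eqP => vr.
  have := vmax 0; rewrite enorm0 => /(_ (ltW rho10)).
  rewrite /F /h dotp0l dotp0l m0 -/(h v).
  have := h_sphere v vr; have := dotp_le v (x - xbar).
  have : rho1 * enorm (x - xbar) < rho1 * (s * rho1 / 2) by rewrite ltr_pM2l.
  by rewrite vr dotpDr dotpNr; lra.
(* Moving [v] by [t *: w] along the residual [w = x - m v], maximality and the subgradient
   inequality give [0 <= dotp w (m' - x)]. As [m] is Lipschitz, [dotp w w] is then at most [t] times
   a constant. *)
have xm : x = m v.
  apply/eqP; rewrite -subr_eq0; apply/eqP.
  have [w wE] : exists w, w = x - m v by exists (x - m v).
  rewrite -wE; apply: dotp_eq0; apply: le_anti; rewrite dotp_ge0 andbT.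
  pose t0 := (rho1 - enorm v) / (enorm w + 1).
  have w1 : 0 < enorm w + 1 by rewrite ltr_wpDl ?enorm_ge0.
  apply: (@ler_of_small _ _ _ (kappa * enorm w ^+ 2) t0).
    by rewrite divr_gt0// subr_gt0.
  move=> t tp; rewrite ler_pdivlMr// => tt0.
  have vt : enorm (v + t *: w) <= rho1.
    by apply: le_trans (enormD _ _) _; rewrite enormZ gtr0_norm//; lra.
  have vte := le_lt_trans vt rho1e.
  have := vmax _ vt; have := h_sub v _ ve vte.
  have := mlip _ _ vte ve; rewrite addrAC subrr add0r enormZ gtr0_norm//.
  set m' := m (v + t *: w) => ml; rewrite /F dotpZl dotpDl dotpZl => hs vm.
  have : 0 <= t * dotp w (m' - x) by rewrite dotpDr dotpNr; lra.
  rewrite pmulr_rge0//; have -> : m' - x = m' - m v - w.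
    by rewrite wE opprB addrA subrK.
  have := dotp_le w (m' - m v); have := ler_wpM2l (enorm_ge0 w) ml.
  have -> : dotp w (m' - m v - w) = dotp w (m' - m v) - dotp w w.
    by rewrite [LHS]dotpDr dotpNr.
  lra.
have vr : enorm v < rho by rewrite /rho1 in v2; lra.
by rewrite xm gm.
Qed.

End GradientInverse.

(** * Existence and accuracy of Newton directions *)

Section NewtonStep.
Context {R : realType} {n : nat}.
Variables (f m : 'rV[R]_n -> 'rV[R]_n) (xbar : 'rV[R]_n).
Variables (kappa rho rho0 : R).
Hypotheses (kappa0 : 0 < kappa) (rho00 : 0 < rho0).
Hypothesis m_lip : forall v1 v2, enorm v1 < rho -> enorm v2 < rho ->
  enorm (m v1 - m v2) <= kappa * enorm (v1 - v2).
Hypothesis f_m : forall v, enorm v < rho -> f (m v) = v.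
Hypothesis m_f : forall x, enorm (x - xbar) < rho0 ->
  enorm (f x) < rho /\ m (f x) = x.

Lemma f_metric_regular x y :
  enorm (x - xbar) < rho0 -> enorm (y - xbar) < rho0 ->
  enorm (x - y) <= kappa * enorm (f x - f y).
Proof.
move=> /m_f[fx mx] /m_f[fy my].
by rewrite -{1}mx -{1}my; exact: m_lip.
Qed.

(** Along [m (v k)] the value of [f] is exactly [f x - harmonic k *: f x], and the difference
    quotients are bounded because [m] is Lipschitz. *)
Lemma graph_deriv_Newton_solvable x :
  enorm (x - xbar) < rho0 -> exists d, graph_deriv f x d (- f x).
Proof.
move=> /m_f[fx mfx]; pose v k := f x - harmonic k *: f x.
have h0 k : 0 < harmonic k :> R := harmonic_gt0 k.
have vr k : enorm (v k) < rho.
  apply: le_lt_trans fx; rewrite /v -{1}(scale1r (f x)) -scalerBl enormZ.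
  have h1 : harmonic k <= 1 :> R by rewrite /= invf_le1 ?ltr0n// ler1n.
  rewrite ger0_norm ?subr_ge0// ler_piMl ?enorm_ge0//.
  by rewrite gerBl ltW.
pose u k := (harmonic k)^-1 *: (m (v k) - x).
have uE k : x + harmonic k *: u k = m (v k).
  by rewrite scalerA divff ?gt_eqF// scale1r addrC subrK.
have ub k : enorm (u k) <= kappa * enorm (f x).
  rewrite enormZ gtr0_norm ?invr_gt0// mulrC ler_pdivrMr// -{1}mfx.
  apply: le_trans (m_lip (vr k) fx) _.
  by rewrite /v addrAC subrr add0r enormN enormZ gtr0_norm// [harmonic k * _]mulrC mulrA.
have [d [N [kN cu]]] := bounded_cvg_reindex ub.
exists d, (harmonic \o N), (u \o N), (fun=> - f x); split=> [k|]; first exact: h0.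
split; first exact: (@cvg_reindex _ _ _ N kN cvg_harmonic).
split=> //; split; first exact: cvg_cst.
by move=> k /=; rewrite uE f_m// scalerN.
Qed.

Lemma Newton_step_superlinear (r L eps : R) :
  0 < r -> 0 < L ->
  (forall x y, enorm (x - xbar) < r -> enorm (y - xbar) < r ->
     enorm (f x - f y) <= L * enorm (x - y)) ->
  f xbar = 0 -> semismooth_star f xbar -> 0 < eps ->
  exists2 delta : R, 0 < delta & forall x d, enorm (x - xbar) < delta ->
    graph_deriv f x d (- f x) -> enorm (x + d - xbar) <= eps * enorm (x - xbar).
Proof.
move=> r0 L0 lip f0 ss eps0.
have [d0 d00 dir] := semismooth_star_directional r0 L0 lip ss (divr_gt0 eps0 kappa0).
exists (Num.min d0 (rho0 / 2)); first by rewrite lt_min d00 divr_gt0.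
move=> x d; rewrite lt_min => /andP[/dir[tau tau0 {}dir] xr].
move=> [t [u [w [t0 [/cvgrPdist_le ct [/cvg_enormP cu [/cvg_enormP cw uE]]]]]]].
have [e eE] : exists e, e = xbar - x by exists (xbar - x).
have -> : x + d - xbar = d - e by rewrite eE opprB addrCA addrA.
(* The slack [h] bounds both [u k - d] and [w k - - f x]; the first enters once, the second
   multiplied by [kappa]. *)
apply: (@ler_of_small _ _ _ (1 + kappa) 1) => // h h0 h1.
have D0 : 0 < enorm d + 1 by rewrite ltr_wpDl ?enorm_ge0.
(* The bounds serve, in order, the directional estimate, the point [x + t k *: e] and the point
   [x + t k *: u k], both to lie within [rho0] of [xbar]. *)
have ct' : \forall k \near \oo,
    `|0 - t k| <= Num.min tau (Num.min 1 (rho0 / 2 / (enorm d + 1) / 2)).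
  by apply: ct; rewrite !lt_min tau0 ltr01 !divr_gt0.
have [k [[uk wk]]] := filter_ex (filterI (filterI (cu _ h0) (cw _ h0)) ct').
rewrite sub0r normrN gtr0_norm// !le_min => /and3P[tk1 tk2].
rewrite !ler_pdivlMr// => tk3.
have ukd : enorm (u k) <= enorm d + 1.
  by have := enorm_le_distD (u k) d; lra.
have xu : enorm (x + t k *: u k - xbar) < rho0.
  have : t k * enorm (u k) <= t k * (enorm d + 1) by rewrite ler_pM2l.
  have := enormD (t k *: u k) (x - xbar); rewrite enormZ gtr0_norm//.
  by rewrite addrCA addrA; have := mulr_gt0 (t0 k) D0; lra.
have xe : enorm (x + t k *: e - xbar) < rho0.
  have : t k * enorm (x - xbar) <= enorm (x - xbar) by rewrite ler_piMl ?enorm_ge0.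
  have := enormD (t k *: e) (x - xbar); rewrite enormZ gtr0_norm// eE enormB.
  by rewrite addrCA addrA; lra.
have := f_metric_regular xu xe.
have -> : x + t k *: u k - (x + t k *: e) = t k *: (u k - e).
  by rewrite opprD addrACA subrr add0r scalerBr.
rewrite (uE k) enormZ gtr0_norm//.
have := dir _ (t0 k) tk1; rewrite -eE f0 subr0.
move: (f (x + t k *: e)) => y dirk.
have -> : f x + t k *: w k - y = t k *: (w k - - f x) - (y - f x + t k *: f x).
  by rewrite opprK; apply/rowP => i; rewrite !mxE; ring.
have := enormD (t k *: (w k - - f x)) (- (y - f x + t k *: f x)).
rewrite enormN enormZ gtr0_norm// => fwk uke.
have {}uke : enorm (u k - e) <= kappa * (h + eps / kappa * enorm (x - xbar)).
  rewrite -(ler_pM2l (t0 k)); apply: le_trans uke _.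
  rewrite mulrCA ler_pM2l//; apply: le_trans fwk _; rewrite mulrDr.
  by apply: lerD dirk; rewrite ler_pM2l.
have kE : kappa * (eps / kappa * enorm (x - xbar)) = eps * enorm (x - xbar).
  by field; rewrite gt_eqF.
by have := enorm_dist (u k) d e; rewrite (enormB d (u k)); rewrite mulrDr kE in uke; lra.
Qed.

End NewtonStep.

(** * Well-definedness and superlinear convergence of the Newton iteration *)

Theorem theorem5p4 (R : realType) (n : nat) (phi : 'rV[R]_n -> R)
  (xbar : 'rV[R]_n) (kappa : R) :
  0 < kappa ->
  C11_near phi xbar ->
  tilt_stable phi xbar kappa ->
  semismooth_star (grad phi) xbar ->
  exists delta : R, 0 < delta /\
    forall x0 : 'rV[R]_n, enorm (x0 - xbar) <= delta ->
      (* well-definedness: Upsilon(x_k) is nonempty at every non-terminal iterate *)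
      (forall (x : nat -> 'rV[R]_n) (k : nat),
          x 0%N = x0 -> algB_run_upto phi x k -> grad phi (x k) != 0 ->
          exists d, Upsilon phi (x k) d) /\
      (* infinite runs converge Q-superlinearly to xbar *)
      (forall x : nat -> 'rV[R]_n,
          x 0%N = x0 -> algB_run_infinite phi x ->
          x @ \oo --> xbar /\
          (forall eps : R, 0 < eps -> exists K : nat, forall k, (K <= k)%N ->
              enorm (x k.+1 - xbar) <= eps * enorm (x k - xbar))).
Proof.
move=> k0 [r [L [r0 [dphi lip]]]] ts ss.
have [m [rho [rho0 [[rho_gt0 rho00 mlip gm mg] g0]]]] :=
  tilt_stable_grad_inverse k0 r0 dphi ts.
(* The given [L] may be nonpositive, while the estimates above divide by the Lipschitz constant. *)
have L0 : 0 < `|L| + 1 by rewrite ltr_wpDl.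
have lip' x y : enorm (x - xbar) < r -> enorm (y - xbar) < r ->
    enorm (grad phi x - grad phi y) <= (`|L| + 1) * enorm (x - y).
  move=> xr yr; apply: le_trans (lip _ _ xr yr) _.
  by rewrite ler_wpM2r ?enorm_ge0//; have := ler_norm L; lra.
have step eps := @Newton_step_superlinear R n (grad phi) m xbar kappa rho rho0 k0 rho00
  mlip mg r (`|L| + 1) eps r0 L0 lip' g0 ss.
have half0 : 0 < 2^-1 :> R by rewrite invr_gt0.
have [d1 d10 half] := step _ half0.
have md0 : 0 < Num.min d1 rho0 by rewrite lt_min d10.
exists (Num.min d1 rho0 / 2); split; first by rewrite divr_gt0.
set delta := Num.min d1 rho0 / 2 => x0 x0d.
have [dd1 drho0] : delta < d1 /\ delta < rho0.
  have : Num.min d1 rho0 <= d1 by rewrite ge_min lexx.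
  have : Num.min d1 rho0 <= rho0 by rewrite ge_min lexx orbT.
  by rewrite /delta; split; lra.
(* Halving the error gives more than this [1 / (k + 1)] rate, which already yields both confinement
   to the ball and convergence; the induction uses [k + 2 <= 2 * (k + 1)]. *)
have decay x k : x 0%N = x0 -> algB_run_upto phi x k ->
    enorm (x k - xbar) * k.+1%:R <= delta.
  move=> x00; elim: k => [_|k IH run]; first by rewrite x00 mulr1.
  have {IH} := IH (fun j jk => run j (ltnW jk)).
  have [_ ups] := run k (ltnSn k); have := enorm_ge0 (x k - xbar) => xk0 xk.
  have k0' := ler0n R k.
  have xk1 : enorm (x k - xbar) < d1.
    by apply: le_lt_trans dd1; apply: le_trans xk; rewrite ler_peMr// ler1n.
  have := half _ _ xk1 ups; rewrite [x k + _]addrC subrK => xk2.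
  move: xk; rewrite -!natr1 => xk.
  apply: le_trans xk.
  have : enorm (x k.+1 - xbar) * (k%:R + 1 + 1) <=
    2^-1 * enorm (x k - xbar) * (k%:R + 1 + 1) by rewrite ler_wpM2r// !addr_ge0.
  nra.
have small x k : x 0%N = x0 -> algB_run_upto phi x k -> enorm (x k - xbar) <= delta.
  move=> x00 /(decay x k x00); apply: le_trans.
  by rewrite ler_peMr ?enorm_ge0// ler1n.
split=> [x k x00 run _|x x00 run].
  apply: (graph_deriv_Newton_solvable mlip gm mg).
  by apply: le_lt_trans drho0; exact: small.
have upto k : algB_run_upto phi x k by move=> j _; exact: run.
have delta0 : 0 < delta by rewrite divr_gt0.
have cx : x @ \oo --> xbar.
  apply/cvg_enormP => e e0.
  have := near_infty_natSinv_lt (PosNum (divr_gt0 e0 delta0)).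
  apply: filterS => k /= /ltW; rewrite ler_pdivlMr// => ke; apply: le_trans ke.
  by rewrite mulrC ler_pdivlMr ?ltr0n//; exact: decay.
split=> // eps /step[d2 d20 sup].
have /cvg_seq_enormP /(_ _ (divr_gt0 d20 (ltr0n R 2)))[K HK] := cx.
exists K => k /HK xk; have [_ ups] := run k.
have xk2 : enorm (x k - xbar) < d2 by lra.
have <- : x k + (x k.+1 - x k) = x k.+1 by rewrite addrC subrK.
exact: sup.
Qed.
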